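(* Let $\Theta\subseteq\mathbb R$ be an open interval containing $0$ and let $(F_\theta)_{\theta\in\Theta}$ be a family of continuous joint cdf's on $\mathbb R^2$ with common marginal cdf's $G$ and $H$ not depending on $\theta$, such that $F_0(x,y)=G(x)H(y)$ for all real $x,y$. Let $$d(\theta):=\|F_\theta-F_0\|:=\int_{\mathbb R^2}|d(F_\theta-F_0)|,\qquad \rho(\theta):=\sup_{(x,y)\in\mathbb R^2}|F_\theta(x,y)-F_0(x,y)|.$$ If $$\tfrac1\theta\,d(\theta)\rho(\theta)\to0\quad\text{as }\theta\to0,\qquad ( * )$$ then $$\frac1\theta\int_{\mathbb R^2}(F_\theta-F_0)\,d(F_\theta-F_0)\to0\quad\text{as }\theta\to0.$$ So, if $( * )$ holds and $$\liminf_{\theta\to0}\Big|\frac1\theta\int_{\mathbb R^2}(F_\theta-F_0)\,dF_0\Big|>0,$$ then $$\frac{\int_{\mathbb R^2}(F_\theta-F_0)\,d(F_\theta-F_0)}{\int_{\mathbb R^2}(F_\theta-F_0)\,dF_0}\to0\quad\text{as }\theta\to0,$$ and hence $\mathsf{ARE}_{T,S}(0)=1$.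
   Context: $\int|d(F_\theta-F_0)|$ is the total variation of the signed measure which is the difference of the probability measures with cdf's $F_\theta$ and $F_0$; integrals against $dF_0$ and $d(F_\theta-F_0)$ are with respect to the corresponding (signed) measures. $\mathsf{ARE}_{T,S}(0)$ is the (two-sided Pitman) asymptotic relative efficiency, at the independence value $\theta=0$, of Kendall's correlation statistic $T$ relative to Spearman's correlation statistic $S$. With $(X,Y)$ having cdf $F_\theta$ under $\mathsf P_\theta$ (expectation $\mathsf E_\theta$, variance $\mathsf{Var}_\theta$), it is defined by $$\mathsf{ARE}_{T,S}(0):=\frac{\sigma_S^2(0)}{\sigma_T^2(0)}\lim_{\theta\to0}\frac{(\mu_T(\theta)-\mu_T(0))^2}{(\mu_S(\theta)-\mu_S(0))^2},$$ where $\mu_T(\theta)=4\,\mathsf E_\theta F_\theta(X,Y)-1$, $\mu_S(\theta)=12\,\mathsf E_\theta G(X)H(Y)-3$, $\sigma_T^2(\theta)=16\,\mathsf{Var}_\theta\big(2F_\theta(X,Y)-G(X)-H(Y)\big)$, and $$\sigma_S^2(\theta)=144\,\mathsf{Var}_\theta\Big((1-G(X))(1-H(Y))+\int_{\mathbb R}F_\theta(X,y)\,dH(y)+\int_{\mathbb R}F_\theta(x,Y)\,dG(x)\Big).$$ The assertion $\mathsf{ARE}_{T,S}(0)=1$ includes existence of the limit. *)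

(* Defs.v *)
From HB Require Import structures.
From mathcomp Require Import all_boot all_order all_algebra.
From mathcomp Require Import all_classical all_reals all_analysis.

Set Implicit Arguments.
Unset Strict Implicit.
Unset Printing Implicit Defensive.

Import Order.TTheory GRing.Theory Num.Theory.
Import numFieldNormedType.Exports.

Local Open Scope classical_set_scope.
Local Open Scope ring_scope.

(* A cdf and the Borel probability measure it determines are interchangeable;
   the measure is taken as the primitive datum, so that integrals "against dF"
   are integrals with respect to the measure whose cdf is F. *)

Notation line R := (measurableTypeR R).
Notation plane R := (measurableTypeR R * measurableTypeR R)%type.

Definition cdf1 (R : realType) (m : probability (line R) R) (x : R) : R :=
  fine (m `]-oo, x]%classic).

Definition cdf2 (R : realType) (Q : probability (plane R) R) (z : R * R) : R :=
  fine (Q (`]-oo, z.1]%classic `*` `]-oo, z.2]%classic)).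

Section signed_measure.
Context d (T : measurableType d) (R : realType).
Implicit Type nu : {charge set T -> \bar R}.

(* The notions below do not depend on which Hahn decomposition is chosen. *)
Lemma hahn_exists nu :
  {PN : set T * set T | hahn_decomposition nu PN.1 PN.2}.
Proof.
apply: cid; have [P [N nuPN]] := Hahn_decomposition nu.
by exists (P, N).
Qed.

Definition charge_pos nu := jordan_pos (svalP (hahn_exists nu)).
Definition charge_neg nu := jordan_neg (svalP (hahn_exists nu)).

(* int |d nu| *)
Definition charge_tv nu : R :=
  fine (charge_variation (svalP (hahn_exists nu)) setT).

(* int f d nu = int f d nu^+ - int f d nu^- *)
Definition charge_integral nu (f : T -> R) : R :=
  (\int[charge_pos nu]_z f z) - (\int[charge_neg nu]_z f z).

Definition diff_charge (P Q : probability T R) : {charge set T -> \bar R} :=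
  cadd (charge_of_finite_measure P) (copp (charge_of_finite_measure Q)).

End signed_measure.

Definition sup_dist (R : realType) (P Q : probability (plane R) R) : R :=
  sup (range (fun z : R * R => `|cdf2 P z - cdf2 Q z|)).

(* The moments below depend only on the law Q of (X, Y), so (X, Y) is taken to
   be the identity of the plane under Q; mG and mH are the laws with cdf's G
   and H. *)
Section moments.
Variable R : realType.
Variables mG mH : probability (line R) R.
Implicit Type Q : probability (plane R) R.

Definition mu_T Q : R := 4 * fine ('E_Q[cdf2 Q])%E - 1.

Definition mu_S Q : R :=
  12 * fine ('E_Q[fun z : plane R => (cdf1 mG z.1 * cdf1 mH z.2)%R])%E - 3.

Definition sigma2_T Q : R :=
  16 * fine ('V_Q[fun z : plane R =>
    (2 * cdf2 Q z - cdf1 mG z.1 - cdf1 mH z.2)%R])%E.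

Definition sigma2_S Q : R :=
  144 * fine ('V_Q[fun z : plane R =>
    ((1 - cdf1 mG z.1) * (1 - cdf1 mH z.2)
     + (\int[mH]_y cdf2 Q (z.1, y)) + (\int[mG]_x cdf2 Q (x, z.2)))%R])%E.

Definition ARE_ratio (P : R -> probability (plane R) R) (theta : R) : R :=
  (mu_T (P theta) - mu_T (P 0)) ^+ 2 / (mu_S (P theta) - mu_S (P 0)) ^+ 2.

(* Existence of the limit is not part of this definition.  Since x / 0 = 0, a
   nonzero value of ARE_TS together with convergence of ARE_ratio forces
   sigma2_T (P 0) != 0 and mu_S (P theta) != mu_S (P 0) for theta near 0. *)
Definition ARE_TS (P : R -> probability (plane R) R) : R :=
  sigma2_S (P 0) / sigma2_T (P 0) * lim (ARE_ratio P theta @[theta --> 0^']).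

End moments.

(* Main.v *)
Require Import Defs.
From HB Require Import structures.
From mathcomp Require Import all_boot all_order all_algebra.
From mathcomp Require Import all_classical all_reals all_analysis.
From mathcomp Require Import measurable_realfun ring lra.

Set Implicit Arguments.
Unset Strict Implicit.
Unset Printing Implicit Defensive.

Import Order.TTheory GRing.Theory Num.Theory.
Import numFieldNormedType.Exports.

Local Open Scope classical_set_scope.
Local Open Scope ring_scope.

(** Write F = F_theta, A = int (F - F_0) dF_0 and B = int (F - F_0) d(F - F_0).
Since |F - F_0| <= rho, the Jordan decomposition gives |B| <= d rho, hence the
first claim.  By Fubini, int F_0 dF is the F_0-integral of
(x, y) |-> P_theta (X >= x, Y >= y), and this probability equals
1 - G x - H y + F (x, y) because the marginals are continuous.  Comparing with
theta = 0 yields int F_0 d(F - F_0) = A.  Therefore mu_T moves by 4 (2 A + B) and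
mu_S by 12 A, so that the squared ratio tends to 4 / 9.  At theta = 0 the variable
defining sigma_S^2 is 1 + W / 2 with W = 2 F_0 - G - H, the one defining sigma_T^2,
so the ratio of the variances is (144 / 4) / 16 = 9 / 4 once Var W <> 0. *)

(** * Bounded integrands against finite measures and against charges *)

Section finite_measures.
Context d (T : measurableType d) (R : realType).
Implicit Types (f : T -> R) (M : R).

Lemma bounded_integrable (m : {finite_measure set T -> \bar R}) f M :
  measurable_fun setT f -> (forall x, `|f x| <= M) ->
  m.-integrable setT (EFin \o f).
Proof.
move=> mf fM; apply: measurable_bounded_integrable => //.
  by rewrite ltey_eq fin_num_measure.
exists M; split; first exact: num_real.
by move=> x Mx y _; exact: le_trans (fM y) (ltW Mx).
Qed.

Lemma Rintegral_norm_le (m : {finite_measure set T -> \bar R}) f M :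
  measurable_fun setT f -> (forall x, `|f x| <= M) ->
  `|\int[m]_x f x| <= M * fine (m setT).
Proof.
move=> mf fM.
apply: le_trans (le_normr_Rintegral _ (bounded_integrable m mf fM)) _ => //.
rewrite -Rintegral_cst//; apply: le_Rintegral => //.
- apply: (@bounded_integrable m (fun x => `|f x|) M) => [|x /=].
    exact: measurableT_comp.
  by rewrite normr_id.
- by apply: (@bounded_integrable m (cst M) `|M|) => /=.
Qed.

(** The hypothesis is rearranged into [p + Q = n + P], an equality of nonnegative finite measures;
    integrating [f] against both sides and subtracting finite values gives the claim. *)
Lemma eq_Rintegral_measureB (p n P Q : {finite_measure set T -> \bar R}) f M :
  measurable_fun setT f -> (forall x, `|f x| <= M) ->
  (forall A, measurable A -> P A - Q A = p A + (-1)%:E * n A)%E ->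
  \int[p]_x f x - \int[n]_x f x = \int[P]_x f x - \int[Q]_x f x.
Proof.
move=> mf fM PQpn.
have intf (m : {finite_measure set T -> \bar R}) :=
  bounded_integrable m mf fM.
have swap (a b p' n' : \bar R) : a \is a fin_num -> b \is a fin_num ->
    p' \is a fin_num -> n' \is a fin_num ->
    (a - b = p' + (-1)%:E * n' -> p' + b = n' + a)%E.
  case: a b p' n' => [a| |] [b| |] [p'| |] [n'| |] // _ _ _ _.
  by rewrite -EFinB -EFinM -!EFinD => -[] h; congr _%:E; lra.
have : (\int[measure_add p Q]_x (EFin \o f) x =
        \int[measure_add n P]_x (EFin \o f) x)%E.
  apply: eq_measure_integral => A mA _.
  transitivity (p A + Q A)%E; first exact: measure_addE.
  transitivity (n A + P A)%E; last exact/esym/measure_addE.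
  by apply: (swap (P A) (Q A)); [exact: fin_num_measure..|exact: PQpn].
rewrite (integral_measure_add measurableT (intf p) (intf Q)).
rewrite (integral_measure_add measurableT (intf n) (intf P)).
have fin (m : {finite_measure set T -> \bar R}) :=
  integrable_fin_num measurableT (intf m).
move=> /(congr1 fine).
rewrite (fineD (fin p) (fin Q)) (fineD (fin n) (fin P)) /Rintegral /=; lra.
Qed.

(** The Jordan parts of the charge have the same difference as [P] and [Q] on every measurable set,
    so the chosen Hahn decomposition drops out. *)
Lemma charge_integral_diff (P Q : probability T R) f M :
  measurable_fun setT f -> (forall x, `|f x| <= M) ->
  charge_integral (diff_charge P Q) f = \int[P]_x f x - \int[Q]_x f x.
Proof.
move=> mf fM; apply: (eq_Rintegral_measureB mf fM) => A mA.
exact: (jordan_decomp (svalP (hahn_exists (diff_charge P Q))) mA).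
Qed.

(** Each Jordan part contributes at most [M] times its mass, and the two masses add up to the total
    variation. *)
Lemma charge_integral_norm_le (nu : {charge set T -> \bar R}) f M :
  measurable_fun setT f -> (forall x, `|f x| <= M) ->
  `|charge_integral nu f| <= charge_tv nu * M.
Proof.
move=> mf fM; rewrite /charge_integral /charge_tv /charge_variation.
apply: le_trans (ler_normB _ _) _.
rewrite fineD ?fin_num_measure// mulrDl !(mulrC _ M) lerD//.
  exact: (Rintegral_norm_le (charge_pos nu)).
exact: (Rintegral_norm_le (charge_neg nu)).
Qed.

Lemma fine_prob_itv01 (P : probability T R) (A : set T) :
  measurable A -> 0 <= fine (P A) <= 1.
Proof.
move=> mA; rewrite fine_ge0//=.
by rewrite -lee_fin fineK ?fin_num_measure// probability_le1.
Qed.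

Lemma fine_probU (P : probability T R) (A B : set T) :
  measurable A -> measurable B ->
  fine (P (A `|` B)) = fine (P A) + fine (P B) - fine (P (A `&` B)).
Proof.
move=> mA mB; rewrite measureUfinl//; last by rewrite ltey_eq fin_num_measure.
have mAB := measurableI _ _ mA mB.
by rewrite fineB ?fineD// ?fin_numD !fin_num_measure.
Qed.

Lemma fine_prob_le (P : probability T R) (A B : set T) :
  measurable A -> measurable B -> A `<=` B -> fine (P A) <= fine (P B).
Proof. by move=> mA mB AB; rewrite fine_le ?fin_num_measure// le_measure ?inE. Qed.

Lemma fine_varianceE (P : probability T R) f :
  fine ('V_P[f])%E = \int[P]_x (f x - \int[P]_y f y) ^+ 2.
Proof.
by rewrite /variance !unlock.
Qed.

End finite_measures.

(** * Tonelli's theorem for the sections of a measurable set *)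

Section section_swap.
Context d1 d2 (T1 : measurableType d1) (T2 : measurableType d2) (R : realType).
Variables (m1 : probability T1 R) (m2 : probability T2 R).
Variables (A : set (T1 * T2)) (mA : measurable A).

Lemma measurable_fine_ysection :
  measurable_fun setT (fun y => fine (m1 (ysection A y))).
Proof.
apply/measurable_EFinP.
apply: (eq_measurable_fun (m1 \o ysection A)); last exact: measurable_fun_ysection.
by move=> y _ /=; rewrite fineK// fin_num_measure//; exact: measurable_ysection.
Qed.

(** Both sides are the product measure of [A], computed by slicing in either order. *)
Lemma Rintegral_section_swap :
  \int[m2]_y fine (m1 (ysection A y)) = \int[m1]_x fine (m2 (xsection A x)).
Proof.
rewrite /Rintegral; congr fine.
transitivity (\int[m2]_y m1 (ysection A y))%E.
  apply: eq_integral => y _ /=; rewrite fineK// fin_num_measure//.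
  exact: measurable_ysection.
transitivity (\int[m1]_x m2 (xsection A x))%E; last first.
  apply: eq_integral => x _ /=; rewrite fineK// fin_num_measure//.
  exact: measurable_xsection.
have := @indic_fubini_tonelli _ _ _ _ R m1 m2 A mA.
by rewrite indic_fubini_tonelli_FE// indic_fubini_tonelli_GE.
Qed.

End section_swap.

(** For [y < x] the events [X = x] and [X <= y] are disjoint and lie in [X <= x], so the level set
    has probability at most the increment of the cdf from [y] to [x], which vanishes as [y]
    increases to [x]. A general [X] covers the identity of the line and both coordinates of the
    plane. *)
Lemma probability_level_eq0 d (T : measurableType d) (R : realType)
    (P : probability T R) (X : T -> R) (x : R) :
  measurable_fun setT X ->
  {for x, continuous (fun t => fine (P (X @^-1` `]-oo, t]%classic)))} ->
  fine (P (X @^-1` [set x])) = 0.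
Proof.
move=> mX cX.
have mpre (B : set R) : measurable B -> measurable (X @^-1` B).
  by move=> mB; rewrite -[_ @^-1` _]setTI; exact: mX.
apply/eqP; rewrite eq_le fine_ge0// andbT; apply/ler_addgt0Pr => e e0.
rewrite add0r.
have /cvgrPdist_lt/(_ _ e0) near_x := cvg_at_left_filter cX.
near x^'- => y.
have yx : y < x by near: y; exact: nbhs_left_lt.
have : `|fine (P (X @^-1` `]-oo, x])) - fine (P (X @^-1` `]-oo, y]))| < e.
  by near: y.
have disj : X @^-1` [set x] `&` X @^-1` `]-oo, y] = set0.
  rewrite -subset0 => t [/= ->]; rewrite in_itv/= => xy.
  by move: yx; rewrite ltNge xy.
have := fine_probU P (mpre _ (measurable_set1 x))
  (mpre _ (measurable_itv `]-oo, y])).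
rewrite disj measure0 /= subr0 => UE.
have : X @^-1` [set x] `|` X @^-1` `]-oo, y] `<=` X @^-1` `]-oo, x].
  move=> t [/= ->|/=]; rewrite !in_itv//= => /le_trans; apply; exact: ltW.
move/(fine_prob_le P); rewrite UE.
move=> /(_ (measurableU _ _ (mpre _ (measurable_set1 x))
  (mpre _ (measurable_itv _))) (mpre _ (measurable_itv _))).
rewrite ltr_norml => le1 /andP[_]; lra.
Unshelve. all: by end_near. Qed.

(** * Cdf's on the line *)

Section cdf1.
Variables (R : realType) (m : probability (line R) R).

Lemma cdf1_itv01 x : 0 <= cdf1 m x <= 1.
Proof. exact: fine_prob_itv01. Qed.

Lemma cdf1_nondecreasing : {homo cdf1 m : x y / x <= y}.
Proof. by move=> x y xy; apply: fine_prob_le => //; exact: subset_itvl. Qed.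

Lemma measurable_cdf1 : measurable_fun setT (cdf1 m : line R -> R).
Proof. exact: nondecreasing_measurable cdf1_nondecreasing. Qed.

Lemma integrable_cdf1 : m.-integrable setT (EFin \o cdf1 m).
Proof.
apply: (bounded_integrable m (M := 1) measurable_cdf1) => x.
by rewrite ger0_norm; case/andP: (cdf1_itv01 x).
Qed.

Lemma cdf1_cvg : (cdf1 m x @[x --> +oo] --> (1 : R)) /\
                 (cdf1 m x @[x --> -oo] --> (0 : R)).
Proof.
(* The identity, packed as a random variable under [m], has cdf [cdf1 m]; this gives access to the
   limits of cdf's at both infinities. *)
pose idl : line R -> R := idfun.
pose midl := @isMeasurableFun.Build _ _ (line R) R idl (@measurable_id _ _ setT).
pose X : {RV m >-> R} := HB.pack_for {RV m >-> R} idl midl.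
split; apply: fine_cvg.
  exact: (cvg_cdfy1 X).
exact: (cvg_cdfNy0 X).
Qed.

Lemma cdf1_surj c : continuous (cdf1 m) -> 0 < c < 1 -> exists x, cdf1 m x = c.
Proof.
move=> cm /andP[c0 c1]; have [cvgy cvgNy] := cdf1_cvg.
near (+oo%R : set_system R) => b; near (-oo%R : set_system R) => a.
have ab : a <= b by near: a; apply: nbhs_ninfty_le; exact: num_real.
have ac : cdf1 m a < c by near: a; exact: (cvgr_lt _ cvgNy).
have cb : c < cdf1 m b by near: b; exact: (cvgr_gt _ cvgy).
have [] := @IVT R (cdf1 m) a b c ab.
- by apply: continuous_subspaceT => x; exact: cm.
- by rewrite ge_min le_max (ltW ac) (ltW cb) orbT.
by move=> x _ <-; exists x.
Unshelve. all: by end_near. Qed.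

Lemma fine_prob_ray x : continuous (cdf1 m) ->
  fine (m `[x, +oo[%classic) = 1 - cdf1 m x.
Proof.
move=> cm; have := probability_level_eq0 (P := m) (X := idfun) (x := x)
  (@measurable_id _ _ _) (cm x).
rewrite preimage_id => mx0.
have := fine_probU m (measurable_itv `[x, +oo[) (measurable_itv `]-oo, x]).
have -> : `[x, +oo[ `|` `]-oo, x] = setT :> set R.
  by rewrite -subTset => y _ /=; rewrite !in_itv/= andbT; apply/orP; exact: le_total.
have -> : `[x, +oo[ `&` `]-oo, x] = [set x] :> set R.
  rewrite eqEsubset; split=> [y /= []|y /= ->]; rewrite !in_itv/= ?andbT ?lexx//.
  by move=> xy yx; apply/eqP; rewrite eq_le xy yx.
rewrite mx0 probability_setT /= /cdf1; lra.
Qed.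

Lemma measurable_le2 : measurable [set p : line R * line R | p.1 <= p.2].
Proof.
rewrite -[X in measurable X]setTI.
exact: (@measurable_fun_ler _ (plane R) R setT fst snd measurable_fst measurable_snd
  measurableT [set true] I).
Qed.

(** For independent [X], [Y] of law [m], slicing the event [X <= Y] in both orders gives the
    integral of [cdf1 m] and that of [1 - cdf1 m], the latter because [m] has no atoms. The two are
    therefore equal and sum to 1. *)
Lemma Rintegral_cdf1 : continuous (cdf1 m) -> \int[m]_x cdf1 m x = 2^-1.
Proof.
move=> cm.
have := Rintegral_section_swap m m measurable_le2.
under eq_Rintegral => y _.
  rewrite (_ : ysection _ y = `]-oo, y]%classic); last first.
    by apply/seteqP; split=> x /=; rewrite ysectionE/= in_itv.
  over.
under [in RHS]eq_Rintegral => x _.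
  rewrite (_ : xsection _ x = `[x, +oo[%classic); last first.
    by apply/seteqP; split=> y /=; rewrite xsectionE/= in_itv/= andbT.
  rewrite fine_prob_ray//.
  over.
have bm := integrable_cdf1.
have i1 : m.-integrable setT (EFin \o cst 1).
  by apply: (bounded_integrable m (M := 1)) => // x; rewrite normr1.
rewrite RintegralB// Rintegral_cst//.
have -> : fine (m [set: line R]) = 1 by rewrite (@probability_setT _ _ _ m).
rewrite /cdf1; lra.
Qed.

End cdf1.

(** * Joint cdf's on the plane *)

Section cdf2.
Variable R : realType.
Implicit Types P Q : probability (plane R) R.

Lemma cdf2_itv01 Q z : 0 <= cdf2 Q z <= 1.
Proof. by apply: fine_prob_itv01; exact: measurableX. Qed.

Lemma cdf2_norm_le1 Q z : `|cdf2 Q z| <= 1.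
Proof. by have /andP[? ?] := cdf2_itv01 Q z; rewrite ger0_norm. Qed.

(** The componentwise order as a set of pairs of points: its sections are lower quadrants in one
    direction and upper quadrants in the other. *)
Let below : set (plane R * plane R) :=
  [set p | p.1.1 <= p.2.1] `&` [set p | p.1.2 <= p.2.2].

Let measurable_below : measurable below.
Proof.
apply: measurableI; rewrite -[X in measurable X]setTI.
  exact: (@measurable_fun_ler _ (plane R * plane R)%type R setT
    (fst \o fst) (fst \o snd)
    (measurableT_comp measurable_fst measurable_fst)
    (measurableT_comp measurable_fst measurable_snd) measurableT [set true] I).
exact: (@measurable_fun_ler _ (plane R * plane R)%type R setT
  (snd \o fst) (snd \o snd)
  (measurableT_comp measurable_snd measurable_fst)
  (measurableT_comp measurable_snd measurable_snd) measurableT [set true] I).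
Qed.

Let ysection_below z :
  ysection below z = `]-oo, z.1]%classic `*` `]-oo, z.2]%classic.
Proof.
by apply/seteqP; split=> w; rewrite ysectionE /below/= !in_itv/=.
Qed.

Let xsection_below w :
  xsection below w = `[w.1, +oo[%classic `*` `[w.2, +oo[%classic.
Proof.
by apply/seteqP; split=> z; rewrite xsectionE /below/= !in_itv/= !andbT.
Qed.

Lemma measurable_cdf2 Q : measurable_fun setT (cdf2 Q : plane R -> R).
Proof.
(* As the measure of a varying section of a measurable set, the joint cdf is measurable by the
   theory behind Tonelli's theorem. *)
rewrite (_ : cdf2 Q = fun z => fine (Q (ysection below z))).
  exact: measurable_fine_ysection.
by apply/funext => z; rewrite ysection_below.
Qed.

Lemma integrable_cdf2 P Q : P.-integrable setT (EFin \o cdf2 Q).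
Proof.
exact: bounded_integrable (@measurable_cdf2 Q) (cdf2_norm_le1 Q).
Qed.

(** Both sides are the probability that [w] lies below [z] componentwise, for independent [w] of law
    [P] and [z] of law [Q]. *)
Lemma Rintegral_cdf2_swap P Q :
  \int[Q]_z cdf2 P z =
  \int[P]_w fine (Q (`[w.1, +oo[%classic `*` `[w.2, +oo[%classic)).
Proof.
transitivity (\int[Q]_z fine (P (ysection below z))).
  by apply: eq_Rintegral => z _; rewrite ysection_below.
rewrite Rintegral_section_swap//.
by apply: eq_Rintegral => w _; rewrite xsection_below.
Qed.

End cdf2.

(** * Integration by parts for joint laws with common continuous marginals *)

Section common_marginals.
Variables (R : realType) (mG mH : probability (line R) R).
Implicit Types P Q : probability (plane R) R.

Definition has_marginals Q :=
  (forall x : R, Q (`]-oo, x]%classic `*` setT) = mG `]-oo, x]%classic) /\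
  (forall y : R, Q (setT `*` `]-oo, y]%classic) = mH `]-oo, y]%classic).

Hypotheses (G_cont : continuous (cdf1 mG)) (H_cont : continuous (cdf1 mH)).

(** Inclusion-exclusion: the quadrant [U] and the half-planes [L], [D] cover the plane, and [U]
    meets [L] or [D] only on the lines through [(x, y)] parallel to the axes, which are null since
    the marginals are continuous. *)
Lemma fine_prob_upper_quadrant Q x y : has_marginals Q ->
  fine (Q (`[x, +oo[%classic `*` `[y, +oo[%classic)) =
  1 - cdf1 mG x - cdf1 mH y + cdf2 Q (x, y).
Proof.
move=> [QG QH].
pose L : set (plane R) := `]-oo, x]%classic `*` setT.
pose D : set (plane R) := setT `*` `]-oo, y]%classic.
pose U : set (plane R) := `[x, +oo[%classic `*` `[y, +oo[%classic.
have mL : measurable L by exact: measurableX.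
have mD : measurable D by exact: measurableX.
have mU : measurable U by exact: measurableX.
have LD : fine (Q (L `&` D)) = cdf2 Q (x, y).
  by rewrite /L /D -setXI setIT setTI.
have ULD : U `|` (L `|` D) = setT.
  rewrite -subTset /U /L /D => -[a b] _ /=; rewrite !in_itv/= !andbT.
  case: (leP x a) => [_|/ltW ax]; last by right; left.
  by case: (leP y b) => [_|/ltW bY]; [left|right; right].
have fst0 : fine (Q (fst @^-1` [set x])) = 0.
  apply: probability_level_eq0 => //.
  rewrite (_ : (fun t => _) = cdf1 mG); first exact: G_cont.
  apply/funext => t.
  by rewrite /cdf1 -QG; congr (fine (Q _)); apply/seteqP; split=> -[a b] //= [].
have snd0 : fine (Q (snd @^-1` [set y])) = 0.
  apply: probability_level_eq0 => //.
  rewrite (_ : (fun t => _) = cdf1 mH); first exact: H_cont.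
  apply/funext => t.
  by rewrite /cdf1 -QH; congr (fine (Q _)); apply/seteqP; split=> -[a b] //= [].
have mx : measurable (fst @^-1` [set x] : set (plane R)).
  by rewrite -[X in measurable X]setTI; exact: measurable_fst.
have my : measurable (snd @^-1` [set y] : set (plane R)).
  by rewrite -[X in measurable X]setTI; exact: measurable_snd.
have I0 : fine (Q (U `&` (L `|` D))) = 0.
  apply/eqP; rewrite eq_le fine_ge0// andbT.
  apply: (@le_trans _ _ (fine (Q (fst @^-1` [set x] `|` snd @^-1` [set y])))).
    apply: fine_prob_le; [by apply: measurableI => //; exact: measurableU|
      exact: measurableU|].
    rewrite /U /L /D => -[a b] /=; rewrite !in_itv/= !andbT.
    move=> -[[xa yb]] [[ax _]|[_ bY]].
      by left; apply/eqP; rewrite eq_le ax.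
    by right; apply/eqP; rewrite eq_le bY.
  by rewrite fine_probU// fst0 snd0 addr0 sub0r oppr_le0 fine_ge0.
have := fine_probU Q mU (measurableU _ _ mL mD).
rewrite ULD I0 fine_probU// LD (_ : fine (Q setT) = 1); last first.
  by rewrite (@probability_setT _ _ _ Q).
rewrite -[fine (Q U)]/(fine (Q (`[x, +oo[%classic `*` `[y, +oo[%classic))).
rewrite QG QH -/(cdf1 mG x) -/(cdf1 mH y); lra.
Qed.

Lemma measurable_cdf1_fst : measurable_fun setT (fun z : plane R => cdf1 mG z.1).
Proof. exact: (measurableT_comp (measurable_cdf1 mG) measurable_fst). Qed.

Lemma measurable_cdf1_snd : measurable_fun setT (fun z : plane R => cdf1 mH z.2).
Proof. exact: (measurableT_comp (measurable_cdf1 mH) measurable_snd). Qed.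

Let integrable_upper_quadrant P Q : P.-integrable setT
  (EFin \o (fun z : plane R => 1 - cdf1 mG z.1 - cdf1 mH z.2 + cdf2 Q z)).
Proof.
apply: (bounded_integrable P (M := 2)) => [|z].
  apply: measurable_funD; last exact: measurable_cdf2.
  apply: measurable_funB; last exact: measurable_cdf1_snd.
  by apply: measurable_funB => //; exact: measurable_cdf1_fst.
have := cdf2_itv01 Q z; have := cdf1_itv01 mG z.1; have := cdf1_itv01 mH z.2.
move=> /andP[? ?] /andP[? ?] /andP[? ?].
by rewrite ler_norml; apply/andP; split; lra.
Qed.

(** Swapping turns both integrals on the left into integrals against [P] of upper quadrant
    probabilities; the terms in the common marginals then cancel. *)
Lemma Rintegral_cdf2_by_parts P Q : has_marginals P -> has_marginals Q ->
  \int[Q]_z cdf2 P z - \int[P]_z cdf2 P z =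
  \int[P]_z (cdf2 Q z - cdf2 P z).
Proof.
have swap Q' : has_marginals Q' -> \int[Q']_z cdf2 P z =
    \int[P]_z (1 - cdf1 mG z.1 - cdf1 mH z.2 + cdf2 Q' z).
  move=> mQ'; rewrite Rintegral_cdf2_swap; apply: eq_Rintegral => -[x y] _.
  exact: fine_prob_upper_quadrant.
move=> mP mQ; rewrite (swap Q mQ) (swap P mP) -RintegralB//.
- by apply: eq_Rintegral => z _; ring.
- exact: integrable_upper_quadrant.
- exact: integrable_upper_quadrant.
Qed.

End common_marginals.

(** * Affine changes and strict positivity of the variance *)

Section variance_lemmas.
Context d (T : measurableType d) (R : realType) (P : probability T R).
Variables (f : T -> R) (M : R).
Hypotheses (mf : measurable_fun setT f) (fM : forall x, `|f x| <= M).

Let mean := \int[P]_x f x.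

Let sqr_integrable : P.-integrable setT (EFin \o (fun x => (f x - mean) ^+ 2)).
Proof.
apply: (bounded_integrable P (M := (M + `|mean|) ^+ 2)) => [|x].
  by apply: measurable_funX; apply: measurable_funB.
rewrite normrX lerXn2r ?nnegrE ?addr_ge0 ?normr_ge0//.
  by rewrite (le_trans _ (fM x)).
by rewrite (le_trans (ler_normB _ _))// lerD2r.
Qed.

Lemma fine_variance_affine a b :
  fine ('V_P[fun x => (a + b * f x)%R])%E = b ^+ 2 * fine ('V_P[f])%E.
Proof.
have intf := bounded_integrable P mf fM.
rewrite !fine_varianceE -RintegralZl//.
have -> : \int[P]_x (a + b * f x) = a + b * mean.
  rewrite RintegralD//.
  - rewrite Rintegral_cst// RintegralZl// (_ : fine (P setT) = 1) ?mulr1//.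
    by rewrite probability_setT.
  - by apply: (bounded_integrable P (M := `|a|)).
  - apply: (bounded_integrable P (M := `|b| * M)) => [|x].
      exact: measurable_funM.
    by rewrite normrM ler_wpM2l.
by apply: eq_Rintegral => x _; rewrite -/mean; ring.
Qed.

(** Markov's inequality, from the pointwise bound of [g] below by [k] times the indicator of [A]. *)
Lemma Rintegral_ge_on (g : T -> R) (k : R) (A : set T) :
  measurable A -> P.-integrable setT (EFin \o g) ->
  (forall x, 0 <= g x) -> (forall x, A x -> k <= g x) ->
  k * fine (P A) <= \int[P]_x g x.
Proof.
move=> mA ig g0 kg.
have iA : P.-integrable setT (EFin \o (\1_A : T -> R)).
  apply: (bounded_integrable P (M := 1)) => [|x]; first exact: measurable_indic.
  by rewrite indicE; case: (x \in A); rewrite ?normr1 ?normr0.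
have -> : fine (P A) = \int[P]_x (\1_A x : R).
  by rewrite /Rintegral integral_indic// setIT.
rewrite -RintegralZl//; apply: le_Rintegral => // [|x _].
  apply: (bounded_integrable P (M := `|k|)) => [|x].
    by apply: measurable_funM => //; exact: measurable_indic.
  by rewrite normrM ler_piMr// indicE; case: (x \in A); rewrite ?normr1 ?normr0.
rewrite indicE; case: (boolP (x \in A)) => [/set_mem/kg|_]; first by rewrite mulr1.
by rewrite mulr0.
Qed.

(* The mean is at distance at least (u - v) / 2 from u or from v. *)
Lemma fine_variance_gt0 (A B : set T) (u v : R) :
  measurable A -> measurable B -> 0 < fine (P A) -> 0 < fine (P B) ->
  (forall x, A x -> u <= f x) -> (forall x, B x -> f x <= v) -> v < u ->
  0 < fine ('V_P[f])%E.
Proof.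
move=> mA mB PA PB uf fv vu; rewrite fine_varianceE -/mean.
pose k := ((u - v) / 2) ^+ 2.
have k0 : 0 < k by rewrite exprn_gt0// divr_gt0// subr_gt0.
have sq x : 0 <= (f x - mean) ^+ 2 by exact: sqr_ge0.
have [cle|clt] := leP mean ((u + v) / 2).
  apply: (lt_le_trans (mulr_gt0 k0 PA)); apply: Rintegral_ge_on => // x /uf ufx.
  by rewrite lerXn2r ?nnegrE; lra.
apply: (lt_le_trans (mulr_gt0 k0 PB)); apply: Rintegral_ge_on => // x /fv fvx.
by rewrite -[leRHS]sqrrN lerXn2r ?nnegrE; lra.
Qed.

End variance_lemmas.

(** * The two asymptotic variances under independence *)

Section independence.
Variables (R : realType) (P : probability (plane R) R).
Variables mG mH : probability (line R) R.
Hypothesis F_cont : continuous (cdf2 P).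
Hypothesis F_indep : forall x y : R, cdf2 P (x, y) = cdf1 mG x * cdf1 mH y.

Let cdf1_pos (m : probability (line R) R) : exists y, 0 < cdf1 m y.
Proof.
have [cvgy _] := cdf1_cvg m.
near (+oo%R : set_system R) => y; exists y; near: y.
exact: (cvgr_gt _ cvgy).
Unshelve. all: by end_near. Qed.

(** Continuity passes from the joint cdf to its factor after fixing [y] with [cdf1 mH y > 0] and
    dividing by that constant. *)
Lemma continuous_cdf1_fst : continuous (cdf1 mG).
Proof.
have [y Hy] := cdf1_pos mH.
have -> : cdf1 mG = (fun x => cdf2 P (x, y) / cdf1 mH y).
  by apply/funext => x; rewrite F_indep mulfK// gt_eqF.
move=> x; apply: cvgMr_tmp.
apply: (@continuous_comp R (R * R)%type R (fun x => (x, y)) (cdf2 P) x).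
  apply: (@cvg_pair _ _ _ (nbhs x) (nbhs x) (nbhs y) _ _ _ id (cst y)).
    exact: cvg_id.
  exact: cvg_cst.
exact: F_cont.
Qed.

Lemma continuous_cdf1_snd : continuous (cdf1 mH).
Proof.
have [x Gx] := cdf1_pos mG.
have -> : cdf1 mH = (fun y => cdf2 P (x, y) / cdf1 mG x).
  by apply/funext => y; rewrite F_indep mulrAC divff ?mul1r// gt_eqF.
move=> y; apply: cvgMr_tmp.
apply: (@continuous_comp R (R * R)%type R (fun y => (x, y)) (cdf2 P) y).
  apply: (@cvg_pair _ _ _ (nbhs y) (nbhs x) (nbhs y) _ _ _ (cst x) id).
    exact: cvg_cst.
  exact: cvg_id.
exact: F_cont.
Qed.

Let W (z : plane R) : R := 2 * cdf2 P z - cdf1 mG z.1 - cdf1 mH z.2.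

Let measurable_W : measurable_fun setT W.
Proof.
apply: measurable_funB; last exact: measurable_cdf1_snd.
apply: measurable_funB; last exact: measurable_cdf1_fst.
by apply: measurable_funM => //; exact: measurable_cdf2.
Qed.

Let W_norm_le z : `|W z| <= 2.
Proof.
have := cdf2_itv01 P z; have := cdf1_itv01 mG z.1; have := cdf1_itv01 mH z.2.
move=> /andP[? ?] /andP[? ?] /andP[? ?].
by rewrite ler_norml /W; apply/andP; split; lra.
Qed.

Let V := fine ('V_P[W])%E.

Hypothesis P_marg : has_marginals mG mH P.

Let V_gt0 : 0 < V.
Proof.
(* W = ((1 - 2 G) (1 - 2 H) - 1) / 2 is at least -3/8 where G, H <= 1/4 and at
   most -5/8 where G <= 1/4 and H >= 3/4; both sets have probability 1/16. *)
have q01 : (0 < 4^-1 :> R) && (4^-1 < 1 :> R) by apply/andP; split; lra.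
have t01 : (0 < 3 / 4 :> R) && (3 / 4 < 1 :> R) by apply/andP; split; lra.
have [a Ga] := cdf1_surj continuous_cdf1_fst q01.
have [b Hb] := cdf1_surj continuous_cdf1_snd q01.
have [c Hc] := cdf1_surj continuous_cdf1_snd t01.
have mA : measurable (`]-oo, a]%classic `*` `]-oo, b]%classic : set (plane R)).
  exact: measurableX.
have mB : measurable (`]-oo, a]%classic `*` `]c, +oo[%classic : set (plane R)).
  exact: measurableX.
apply: (fine_variance_gt0 measurable_W W_norm_le mA mB (u := - (3 / 8))
  (v := - (5 / 8))); last lra.
- by rewrite -[X in 0 < X]/(cdf2 P (a, b)) F_indep Ga Hb; lra.
(* Cutting the half-plane left of [a] at height [c] gives the upper piece probability
   [1/4 - 3/16 = 1/16]. *)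
- have mC : measurable (`]-oo, a]%classic `*` `]-oo, c]%classic : set (plane R)).
    exact: measurableX.
  have := fine_probU P mB mC; rewrite -setXI setIid.
  have -> : `]-oo, a]%classic `*` `]c, +oo[%classic `|`
      `]-oo, a]%classic `*` `]-oo, c]%classic =
      `]-oo, a]%classic `*` setT :> set (R * R).
    apply/seteqP; split=> -[x y] /=; rewrite !in_itv/= andbT; first by case=> -[].
    by move=> [-> _]; case: (leP y c) => _; [right|left].
  have -> : `]c, +oo[ `&` `]-oo, c] = set0 :> set R.
    rewrite -subset0 => y [] /=; rewrite !in_itv/= andbT => cy.
    by rewrite leNgt cy.
  rewrite setX0 measure0 P_marg.1 -/(cdf1 mG a) -/(cdf2 P (a, c)) F_indep Ga Hc /=.
  lra.
(* Here [1 - 2 G] and [1 - 2 H] are both at least 1/2, so their product is at least 1/4; on the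
   other set the second factor is at most -1/2 and the product at most -1/4. *)
- move=> [x y] /= []; rewrite !in_itv/= /W F_indep/= => /cdf1_nondecreasing - /(_ mG).
  rewrite Ga => Gx /cdf1_nondecreasing - /(_ mH); rewrite Hb => Hy.
  have /andP[? ?] := cdf1_itv01 mG x; have /andP[? ?] := cdf1_itv01 mH y.
  nra.
- move=> [x y] /= []; rewrite !in_itv/= andbT /W F_indep/= => /cdf1_nondecreasing - /(_ mG).
  rewrite Ga => Gx /ltW/cdf1_nondecreasing - /(_ mH); rewrite Hc => Hy.
  have /andP[? ?] := cdf1_itv01 mG x; have /andP[? ?] := cdf1_itv01 mH y.
  nra.
Qed.

Lemma sigma2_S_T : sigma2_S mG mH P / sigma2_T mG mH P = 9 / 4.
Proof.
rewrite /sigma2_T -/W -/V /sigma2_S.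
have -> : (fun z : plane R => (1 - cdf1 mG z.1) * (1 - cdf1 mH z.2)
     + (\int[mH]_y cdf2 P (z.1, y)) + (\int[mG]_x cdf2 P (x, z.2))) =
   (fun z => 1 + 2^-1 * W z).
  (* By independence and [Rintegral_cdf1] the two inner integrals are [G x / 2] and [H y / 2]. *)
  apply/funext => -[x y] /=.
  under eq_Rintegral => t _ do rewrite F_indep.
  under [X in _ + X = _]eq_Rintegral => t _ do rewrite F_indep.
  rewrite RintegralZl; [|by []|exact: integrable_cdf1].
  rewrite RintegralZr; [|by []|exact: integrable_cdf1].
  rewrite !Rintegral_cdf1 /W ?F_indep /=; last first.
  - exact: continuous_cdf1_snd.
  - exact: continuous_cdf1_fst.
  by field.
rewrite (fine_variance_affine P measurable_W W_norm_le) -/V.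
(* Cancelling the variance of [W] rests on [V_gt0]; a zero variance would make the quotient 0 by
   convention. *)
by field; rewrite gt_eqF.
Qed.

End independence.

(** The lower limit is minus an infimum, over punctured neighbourhoods, of suprema of [- f]; if that
    infimum is negative, then so is the supremum on a single neighbourhood. *)
Lemma lime_inf_gt0 (R : realType) (f : R -> \bar R) (a : R) :
  (0 < lime_inf f a)%E ->
  exists2 c : R, 0 < c & \forall x \near a^', (c%:E <= f x)%E.
Proof.
rewrite /lime_inf oppe_gt0 /lime_sup /limf_esup => /ereal_inf_lt[_ [A aA <-]] lt0.
have fA x : A x -> (- f x <= ereal_sup [set - f x | x in A])%E.
  by move=> Ax; apply: ereal_sup_ubound; exists x.
move: lt0 fA; case: (ereal_sup _) => [r| |]//= r0 fA.
- exists (- r); first by rewrite oppr_gt0.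
  by apply: filterS aA => x /fA; rewrite EFinN leeNl.
(* A supremum equal to [-oo] forces [f = +oo] on the neighbourhood, so any positive constant will
   do. *)
- exists 1 => //; apply: filterS aA => x /fA.
  by rewrite leeNy_eq => /eqP/(congr1 oppe); rewrite oppeK => -> /=; rewrite leey.
Qed.

Lemma sup_dist_ge (R : realType) (P Q : probability (plane R) R) (z : R * R) :
  `|cdf2 P z - cdf2 Q z| <= sup_dist P Q.
Proof.
apply: ub_le_sup; last by exists z.
(* A real [sup] is known to dominate its set only once that set is bounded above; cdf's with values
   in [[0, 1]] supply the crude bound 2. *)
exists 2 => _ [w _ <-]; apply: le_trans (ler_normB _ _) _.
by rewrite -[2]/(1 + 1) lerD// cdf2_norm_le1.
Qed.

(** * The limit at independence and the value of the efficiency *)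

Theorem proposition4p2 (R : realType) (Theta : set R)
    (Theta_open : open Theta) (Theta_itv : is_interval Theta)
    (Theta0 : Theta 0)
    (P : R -> probability (plane R) R) (mG mH : probability (line R) R)
    (F_cont : forall theta, Theta theta -> continuous (cdf2 (P theta)))
    (F_margG : forall theta, Theta theta ->
      forall x : R, P theta (`]-oo, x]%classic `*` setT) = mG `]-oo, x]%classic)
    (F_margH : forall theta, Theta theta ->
      forall y : R, P theta (setT `*` `]-oo, y]%classic) = mH `]-oo, y]%classic)
    (F_indep : forall x y : R, cdf2 (P 0) (x, y) = cdf1 mG x * cdf1 mH y) :
  let D theta (z : R * R) := cdf2 (P theta) z - cdf2 (P 0) z in
  let dD theta := diff_charge (P theta) (P 0) in
  let d theta := charge_tv (dD theta) in
  let rho theta := sup_dist (P theta) (P 0) in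
  let star := theta^-1 * (d theta * rho theta) @[theta --> 0^'] --> (0 : R) in
  (star ->
     theta^-1 * charge_integral (dD theta) (D theta) @[theta --> 0^']
       --> (0 : R))
  /\
  (star ->
   (0 < lime_inf (fun theta : R =>
      `|theta^-1 * (\int[P 0]_z D theta z)|%:E) 0)%E ->
   [/\ charge_integral (dD theta) (D theta) / (\int[P 0]_z D theta z)
         @[theta --> 0^'] --> (0 : R),
       cvg (ARE_ratio mG mH P theta @[theta --> 0^']) &
       ARE_TS mG mH P = 1]).
Proof.
move=> D dD d rho star.
have near_Theta : \forall theta \near (0 : R)^', Theta theta.
  by apply: nbhs_dnbhs; exact: open_nbhs_nbhs.
have P0_cont := F_cont 0 Theta0.
have G_cont := continuous_cdf1_fst P0_cont F_indep.
have H_cont := continuous_cdf1_snd P0_cont F_indep.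
have marg theta : Theta theta -> has_marginals mG mH (P theta).
  by move=> th; split; [exact: F_margG|exact: F_margH].
have mD theta : measurable_fun setT (D theta : plane R -> R).
  by apply: measurable_funB; exact: measurable_cdf2.
have D_le theta z : `|D theta z| <= rho theta by exact: sup_dist_ge.
pose A theta : R := \int[P 0]_z D theta z.
pose B theta : R := charge_integral (dD theta) (D theta).
have part1 : star -> theta^-1 * B theta @[theta --> 0^'] --> (0 : R).
  move=> /cvgr0Pnorm_lt star0; apply/cvgr0Pnorm_lt => e e0.
  apply: filterS (star0 e e0) => theta; apply: le_lt_trans.
  have B_le : `|B theta| <= d theta * rho theta.
    exact: charge_integral_norm_le (mD theta) (D_le theta).
  by rewrite normrM [leRHS]normrM ler_wpM2l// (le_trans B_le)// ler_norm.
split=> // star0 liminf_gt0.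
have [c c0 A_ge] := lime_inf_gt0 liminf_gt0.
(* This keeps the later quotients by [A theta] genuine, away from the convention [x / 0 = 0]. *)
have A_neq0 : \forall theta \near (0 : R)^', A theta != 0.
  apply: filterS A_ge => theta; rewrite lee_fin => /(lt_le_trans c0).
  by rewrite normr_gt0 mulf_eq0 negb_or => /andP[].
have BA : B theta / A theta @[theta --> 0^'] --> (0 : R).
  have /cvgr0Pnorm_lt B0 := part1 star0.
  apply/cvgr0Pnorm_lt => e e0; near=> theta.
  have th0 : theta != 0 by near: theta; exact: nbhs_dnbhs_neq.
  have A0 : A theta != 0 by near: theta.
  have cA : c <= `|theta^-1 * A theta|.
    by rewrite -lee_fin; near: theta; exact: A_ge.
  (* The scaled denominator is at least [c] in modulus, so a tolerance [e * c] for the scaled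
     numerator suffices. *)
  have -> : B theta / A theta = (theta^-1 * B theta) / (theta^-1 * A theta).
    by field; rewrite th0 A0.
  rewrite normrM normfV ltr_pdivrMr; last exact: lt_le_trans cA.
  apply: (@lt_le_trans _ _ (e * c)); last by rewrite ler_pM2l.
  by near: theta; apply: B0; exact: mulr_gt0.
have ratioE : \forall theta \near (0 : R)^',
    ARE_ratio mG mH P theta = ((2 + B theta / A theta) / 3) ^+ 2.
  near=> theta.
  have th : Theta theta by near: theta.
  have A0 : A theta != 0 by near: theta.
  have iF theta' theta'' := integrable_cdf2 (P theta') (P theta'').
  have AE : A theta = \int[P theta]_z cdf2 (P 0) z - \int[P 0]_z cdf2 (P 0) z.
    rewrite (Rintegral_cdf2_by_parts G_cont H_cont (marg _ Theta0) (marg _ th)).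
    by [].
  have BE : B theta = \int[P theta]_z cdf2 (P theta) z -
      \int[P theta]_z cdf2 (P 0) z - A theta.
    rewrite /B (charge_integral_diff _ _ (mD theta) (D_le theta)) -/(A theta).
    by congr (_ - _); rewrite RintegralB; [|by []|exact: iF|exact: iF].
  have muT theta' : mu_T (P theta') = 4 * \int[P theta']_z cdf2 (P theta') z - 1.
    by rewrite /mu_T unlock.
  (* The product of the marginal cdf's is the cdf of [P 0], so [mu_S] is governed by the integral
     occurring in [AE]. *)
  have muS theta' : mu_S mG mH (P theta') = 12 * \int[P theta']_z cdf2 (P 0) z - 3.
    rewrite /mu_S unlock; congr (12 * _ - 3); apply: eq_Rintegral => -[x y] _ /=.
    by rewrite F_indep.
  have dT : mu_T (P theta) - mu_T (P 0) = 4 * (2 * A theta + B theta).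
    by rewrite !muT BE AE; ring.
  have dS : mu_S mG mH (P theta) - mu_S mG mH (P 0) = 12 * A theta.
    by rewrite !muS AE; ring.
  by rewrite /ARE_ratio dT dS; field.
have ratio_cvg : ARE_ratio mG mH P theta @[theta --> 0^'] --> (4 / 9 : R).
  have -> : 4 / 9 = (2 + 0) / 3 * ((2 + 0) / 3) :> R by field.
  have q_cvg : (2 + B theta / A theta) / 3 @[theta --> 0^'] --> ((2 + 0) / 3 : R).
    by apply: cvgMr_tmp; apply: cvgD => //; exact: cvg_cst.
  apply: cvg_trans (cvgM q_cvg q_cvg).
  by apply: near_eq_cvg; apply: filterS ratioE => theta ->.
split; [exact: BA|by apply/cvg_ex; exists (4 / 9)|].
rewrite /ARE_TS (cvg_lim _ ratio_cvg)// sigma2_S_T//; last exact: marg.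
by field.
Unshelve. all: by end_near. Qed.
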